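(* Fix positive integers $r_1<r_2<\cdots<r_k$. Then there are only finitely many vectors $q=(r_1^{x_1},\ldots,r_k^{x_k})$ (with $x_1,\ldots,x_k$ positive integers) such that $\Delta_{(1,q)}$ is reflexive, has the integer decomposition property, and does not admit a decomposition as an affine free sum of two lower-dimensional simplices of the form $\Delta_{(1,p)}$ and $\Delta_{(1,p')}$.
   Context: $(r_1^{x_1},\ldots,r_k^{x_k})$ denotes the vector with $x_1$ copies of $r_1$, then $x_2$ copies of $r_2$, etc. For $q=(q_1,\ldots,q_n)$ a weakly increasing vector of positive integers, $\Delta_{(1,q)}:=\operatorname{conv}\{e_1,\ldots,e_n,-\sum_i q_ie_i\}\subset\mathbb{R}^n$. A lattice polytope containing $0$ in its interior is reflexive if its polar is a lattice polytope; for $\Delta_{(1,q)}$ this is equivalent to $q_j\mid 1+\sum_{i\ne j}q_i$ for all $j$. A lattice polytope $P\subset\mathbb{R}^n$ has the integer decomposition property if for every positive integer $m$ and every $w\in mP\cap\mathbb{Z}^n$ there exist $x_1,\ldots,x_m\in P\cap\mathbb{Z}^n$ with $w=x_1+\cdots+x_m$. For lattice polytopes $P,Q$, $\operatorname{conv}(P\cup Q)$ is an affine free sum if, up to unimodular equivalence, $P\cap Q=\{0\}$ and the affine spans of $P$ and $Q$ are orthogonal coordinate subspaces.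
   Formalization: The case k = 1, r_1 = 1 is excluded: every Δ_(1,(1^n)) is reflexive, has the integer decomposition property and admits no affine free sum decomposition, so the statement fails for r = (1). *)

(* Defs.v *)
From HB Require Import structures.
From mathcomp Require Import all_boot all_order all_algebra.
From mathcomp Require Import all_classical all_reals all_analysis.

Set Implicit Arguments.
Unset Strict Implicit.
Unset Printing Implicit Defensive.

Import Order.TTheory GRing.Theory Num.Theory.
Import numFieldNormedType.Exports.

Local Open Scope classical_set_scope.
Local Open Scope ring_scope.

Section LatticePolytopes.
Variable R : realType.

Definition conv (n : nat) (A : set 'rV[R]_n) : set 'rV[R]_n :=
  [set x | exists (m : nat) (v : 'I_m -> 'rV[R]_n) (c : 'I_m -> R),
    [/\ forall i, A (v i), forall i, 0 <= c i, \sum_i c i = 1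
      & x = \sum_i c i *: v i]].

Definition aff (n : nat) (A : set 'rV[R]_n) : set 'rV[R]_n :=
  [set x | exists (m : nat) (v : 'I_m -> 'rV[R]_n) (c : 'I_m -> R),
    [/\ forall i, A (v i), \sum_i c i = 1 & x = \sum_i c i *: v i]].

Definition lattice (n : nat) : set 'rV[R]_n :=
  [set x | forall i, x ord0 i \is a Num.int].

Definition lattice_polytope (n : nat) (P : set 'rV[R]_n) : Prop :=
  exists s : seq 'rV[R]_n, [set` s] `<=` @lattice n /\ P = conv [set` s].

Definition polar (n : nat) (P : set 'rV[R]_n) : set 'rV[R]_n :=
  [set y | forall x, P x -> \sum_i x ord0 i * y ord0 i <= 1].

Definition reflexive_polytope (n : nat) (P : set 'rV[R]_n) : Prop :=
  [/\ lattice_polytope P, interior P 0 & lattice_polytope (polar P)].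

Definition integer_decomposition_property (n : nat) (P : set 'rV[R]_n) : Prop :=
  forall (m : nat) (w : 'rV[R]_n), (0 < m)%N ->
    ([set m%:R *: y | y in P] `&` @lattice n) w ->
    exists x : 'I_m -> 'rV[R]_n,
      (forall i, (P `&` @lattice n) (x i)) /\ w = \sum_i x i.

Definition Delta1 (q : seq nat) : set 'rV[R]_(size q) :=
  conv (range (fun i : 'I_(size q) => delta_mx ord0 i : 'rV[R]_(size q)) `|`
        [set - \sum_(i < size q) (nth 0%N q i)%:R *: delta_mx ord0 i]).

(* The ambient dimensions may differ: an affine map carries P onto Q and
   identifies the lattices of the two affine spans. *)
Definition unimodular_equivalent (a n : nat)
    (P : set 'rV[R]_a) (Q : set 'rV[R]_n) : Prop :=
  exists (A : 'M[R]_(a, n)) (b : 'rV[R]_n),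
    set_bij (aff P `&` @lattice a) (aff Q `&` @lattice n)
      (fun x => x *m A + b) /\
    [set x *m A + b | x in P] = Q.

Definition unimodular_map (n : nat) (f : 'rV[R]_n -> 'rV[R]_n) : Prop :=
  exists (U : 'M[int]_n) (b : 'rV[int]_n), U \in unitmx /\
    forall x, f x = x *m map_mx intr U + map_mx intr b.

Definition coordinate_subspace (n : nat) (I : {set 'I_n}) : set 'rV[R]_n :=
  [set x | forall i, i \notin I -> x ord0 i = 0].

Definition affine_free_sum (n : nat) (P Q : set 'rV[R]_n) : Prop :=
  exists f : 'rV[R]_n -> 'rV[R]_n,
    [/\ unimodular_map f,
        (f @` P) `&` (f @` Q) = [set 0]
      & exists I J : {set 'I_n},
          [/\ forall i, i \in I -> i \notin J,
              aff (f @` P) = coordinate_subspace I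
            & aff (f @` Q) = coordinate_subspace J]].

Definition weight_vector (q : seq nat) : Prop :=
  sorted leq q /\ all (ltn 0) q.

Definition decomposes_as_affine_free_sum (q : seq nat) : Prop :=
  exists p p' : seq nat,
    [/\ weight_vector p, weight_vector p', (size p < size q)%N
      & (size p' < size q)%N] /\
  exists P Q : set 'rV[R]_(size q),
    [/\ unimodular_equivalent (@Delta1 p) P,
        unimodular_equivalent (@Delta1 p') Q,
        affine_free_sum P Q
      & @Delta1 q = conv (P `|` Q)].

End LatticePolytopes.

Arguments Delta1 R q : clear implicits.
Arguments lattice R n : clear implicits.

(* (r_1^{x_1}, ..., r_k^{x_k}).  The support r = (1) is exceptional: every
   Delta1 (1^n) is reflexive and has the integer decomposition property, and all
   its proper faces are unimodular simplices, whereas a summand Delta1 p of an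
   affine free sum would be a proper face of normalized volume
   1 + \sum_i p_i >= 2.  Hence none of these simplices decomposes, and a
   finiteness statement has to exclude r = (1). *)
Definition multiplicity_vector (k : nat) (r x : k.-tuple nat) : seq nat :=
  flatten [seq nseq (tnth x i) (tnth r i) | i <- enum 'I_k].

(* Main.v *)
(** Let [M] be the largest entry of [q], occurring [m] times, and let [p] collect
    the entries below [M]; assume [M >= 2].  Reflexivity makes [M] divide
    [1 + \sum p], say with quotient [h], and [- \sum_(q_i = M) e_i] is then a
    lattice point of the [h]-th dilate.  Its barycentric coordinates leave no
    room for a vertex among the summands of an integer decomposition, which
    forces [h = 1], i.e. [1 + \sum p = M].  Hence [q] is [p] followed by [m]
    copies of [1 + \sum p], and [Delta1 q] is the affine free sum of copies of
    [Delta1 p] and [Delta1 (1^m)].  So no nonempty [q] with [M >= 2] is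
    indecomposable. *)

Require Import Defs.
From HB Require Import structures.
From mathcomp Require Import all_boot all_order all_algebra.
From mathcomp Require Import all_classical all_reals all_analysis.
From mathcomp Require Import zify ring lra.
Import Defs.

Set Implicit Arguments.
Unset Strict Implicit.
Unset Printing Implicit Defensive.

Import Order.TTheory GRing.Theory Num.Theory.

Local Open Scope classical_set_scope.
Local Open Scope ring_scope.

(** * Convex and affine hulls, and lattice-preserving affine embeddings *)

Section ConvexHulls.
Variable R : realType.

Lemma conv_gen (n : nat) (A : set 'rV[R]_n) : A `<=` conv A.
Proof.
move=> x Ax; exists 1%N, (fun=> x), (fun=> 1).
by split=> //; rewrite big_ord1 ?scale1r.
Qed.

Lemma conv_mono (n : nat) (A B : set 'rV[R]_n) : A `<=` B -> conv A `<=` conv B.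
Proof.
move=> sAB x [m [v [c [Av c0 c1 ->]]]]; exists m, v, c; split=> // i.
exact/sAB.
Qed.

Lemma conv_le (n : nat) (A : set 'rV[R]_n) (a : 'I_n -> R) (b : R) :
  (forall x, A x -> \sum_i x ord0 i * a i <= b) ->
  forall x, conv A x -> \sum_i x ord0 i * a i <= b.
Proof.
move=> leA x [m [v [c [Av c0 c1 ->]]]].
rewrite (_ : \sum_i _ = \sum_t c t * \sum_i v t ord0 i * a i).
  rewrite -[b]mul1r -c1 mulr_suml; apply: ler_sum => t _.
  by apply: ler_wpM2l => //; apply: leA.
under [RHS]eq_bigr do rewrite mulr_sumr.
rewrite exchange_big; apply: eq_bigr => i _.
rewrite summxE mulr_suml; apply: eq_bigr => t _.
by rewrite mxE mulrA.
Qed.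

Lemma aff_image (a n : nat) (P : set 'rV[R]_a) (A : 'M[R]_(a, n))
    (b : 'rV[R]_n) :
  aff [set x *m A + b | x in P] = [set x *m A + b | x in aff P].
Proof.
have combE m (v : 'I_m -> 'rV[R]_a) (c : 'I_m -> R) : \sum_i c i = 1 ->
    \sum_i c i *: (v i *m A + b) = (\sum_i c i *: v i) *m A + b.
  move=> c1; under eq_bigr do rewrite scalerDr.
  rewrite big_split -scaler_suml c1 scale1r mulmx_suml; congr (_ + _).
  by apply: eq_bigr => i _; rewrite scalemxAl.
apply/seteqP; split=> y /=.
  move=> [m [v [c [Pv c1 ->]]]].
  have /choice [u uP] : forall i, exists x, P x /\ x *m A + b = v i.
    by move=> i; have [x Px <-] := Pv i; exists x.
  exists (\sum_i c i *: u i).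
    by exists m, u, c; split=> // i; have [] := uP i.
  rewrite -combE //; apply: eq_bigr => i _.
  by have [_ ->] := uP i.
move=> [x [m [v [c [Pv c1 ->]]]] <-].
exists m, (fun i => v i *m A + b), c; split=> //; last by rewrite combE.
by move=> i; exists (v i).
Qed.

Lemma lattice_mulmx (a n : nat) (x : 'rV[R]_a) (A : 'M[int]_(a, n)) :
  lattice R a x -> lattice R n (x *m map_mx intr A).
Proof.
move=> xZ j; rewrite mxE; apply: rpred_sum => i _.
by rewrite !mxE rpredM // intr_int.
Qed.

(** The integral right inverse [B] gives injectivity and pulls lattice points of the image span back
    to lattice points, so the image lattice is the full lattice of that span. *)
Lemma unimodular_equivalent_embedding (a n : nat) (P : set 'rV[R]_a)
    (A : 'M[int]_(a, n)) (B : 'M[int]_(n, a)) (b : 'rV[int]_n) :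
  A *m B = 1%:M ->
  unimodular_equivalent P
    [set x *m map_mx intr A + map_mx intr b | x in P].
Proof.
move=> AB; exists (map_mx intr A), (map_mx intr b); split=> //.
have gK (x : 'rV[R]_a) :
    (x *m map_mx intr A + map_mx intr b - map_mx intr b) *m map_mx intr B = x.
  by rewrite addrK -mulmxA -map_mxM AB map_mx1 mulmx1.
have bZ (y : 'rV[int]_n) : lattice R n (map_mx intr y).
  by move=> i; rewrite mxE intr_int.
split.
- move=> x [Px xZ]; split; first by rewrite aff_image; exists x.
  by move=> i; rewrite mxE rpredD ?bZ //; apply: lattice_mulmx.
- by move=> x y _ _ eqxy; rewrite -[x]gK -[y]gK eqxy.
- move=> y [+ yZ]; rewrite aff_image => -[x Px xy].
  exists x => //; split=> //; rewrite -[x]gK xy; apply: lattice_mulmx => i.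
  by rewrite !mxE rpredB ?yZ // intr_int.
Qed.

End ConvexHulls.

(** * Facet description of the weighted simplex *)

Section WeightedSimplex.
Variables (R : realType) (n : nat) (c : 'I_n -> nat).

Definition apex : 'rV[R]_n := - \sum_(i < n) (c i)%:R *: delta_mx ord0 i.

(** [Delta1 R q] is convertible to the instance where [c i] is [nth 0 q i]; weights given by a
    function avoid casts between dimensions. *)
Definition wsimplex : set 'rV[R]_n :=
  conv (range (fun i : 'I_n => delta_mx ord0 i : 'rV[R]_n) `|` [set apex]).

(** The normalized volume of the simplex. *)
Local Notation vol := ((\sum_i c i).+1).

Lemma apexE (i : 'I_n) : apex ord0 i = - (c i)%:R.
Proof.
rewrite mxE summxE (bigD1 i) //= big1 ?addr0 => [|j ji].
  by rewrite !mxE !eqxx mulr1.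
by rewrite !mxE eqxx eq_sym (negbTE ji) mulr0.
Qed.

Lemma volE : vol%:R = 1 + \sum_i (c i)%:R :> R.
Proof. by rewrite -add1n natrD natr_sum. Qed.

Lemma vol_gt0 : 0 < vol%:R :> R.
Proof. by rewrite ltr0n. Qed.

(* [(1 - \sum_i x_i) / vol] is the barycentric coordinate of [x] at the apex. *)
Lemma barycentric (x : 'rV[R]_n) :
  let t := (1 - \sum_i x ord0 i) / vol%:R in
  exists (v : 'I_n.+1 -> 'rV[R]_n) (d : 'I_n.+1 -> R),
  [/\ forall i, (range (fun i : 'I_n => delta_mx ord0 i : 'rV[R]_n) `|`
                  [set apex]) (v i),
      d ord0 = t, forall i, d (lift ord0 i) = x ord0 i + (c i)%:R * t,
      \sum_i d i = 1 & x = \sum_i d i *: v i].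
Proof.
move=> t.
exists (fun i => if unlift ord0 i is Some j then delta_mx ord0 j else apex).
exists (fun i => if unlift ord0 i is Some j then x ord0 j + (c j)%:R * t else t).
split.
- by move=> i; case: unliftP => [j _|_]; [left; exists j | right].
- by rewrite unlift_none.
- by move=> i; rewrite liftK.
- rewrite big_ord_recl unlift_none; under eq_bigr do rewrite liftK.
  have : vol%:R * t = 1 - \sum_i x ord0 i.
    by rewrite mulrC divfK // lt0r_neq0 // vol_gt0.
  by rewrite volE big_split -mulr_suml /= => ?; lra.
- rewrite big_ord_recl unlift_none; under eq_bigr do rewrite liftK.
  apply/rowP => i; rewrite mxE mxE apexE summxE (bigD1 i) //= big1 => [|j ji].
    by rewrite !mxE !eqxx mulr1 addr0 mulrN mulrC addrC addrK.
  by rewrite !mxE eqxx eq_sym (negbTE ji) mulr0.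
Qed.

(** The inequalities are affine, hence pass to hulls. [X] is general because it serves both for the
    vertices and for the union of the two free summands. *)
Lemma conv_facet_ineq (X : set 'rV[R]_n) :
  (forall x, X x -> \sum_i x ord0 i <= 1 /\
    forall i, 0 <= vol%:R * x ord0 i + (c i)%:R * (1 - \sum_l x ord0 l)) ->
  forall x, conv X x -> \sum_i x ord0 i <= 1 /\
    forall i, 0 <= vol%:R * x ord0 i + (c i)%:R * (1 - \sum_l x ord0 l).
Proof.
move=> ineqX x Xx.
have sum1 (y : 'rV[R]_n) : \sum_i y ord0 i * 1 = \sum_i y ord0 i.
  by apply: eq_bigr => i _; rewrite mulr1.
(* The facet inequality at [i] is put in the form required by [conv_le], with right-hand side
   [c i]. *)
have sumc i (y : 'rV[R]_n) :
    \sum_l y ord0 l * ((c i)%:R - vol%:R * (l == i)%:R) =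
    (\sum_l y ord0 l) * (c i)%:R - vol%:R * y ord0 i.
  under [LHS]eq_bigr do rewrite mulrBr.
  rewrite sumrB -mulr_suml [X in _ - X](bigD1 i) //= [X in _ - (_ + X)]big1.
    by rewrite eqxx mulr1 addr0 [X in _ - X]mulrC.
  by move=> l /negbTE ->; rewrite !mulr0.
split=> [|i].
  rewrite -sum1; apply: (conv_le _ Xx) => y /ineqX [y1 _].
  by rewrite sum1.
have /conv_le/(_ _ Xx) : forall y, X y ->
    \sum_l y ord0 l * ((c i)%:R - vol%:R * (l == i)%:R) <= (c i)%:R.
  by move=> y /ineqX [_ /(_ i) ?]; rewrite sumc; lra.
by rewrite sumc => ?; lra.
Qed.

(** The first inequality is the facet opposite the apex, the others those opposite the [e_i]; each
    left-hand side at [i] is [vol] times the barycentric coordinate at [e_i]. *)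
Lemma wsimplexP (x : 'rV[R]_n) :
  wsimplex x <-> \sum_i x ord0 i <= 1 /\
    forall i, 0 <= vol%:R * x ord0 i + (c i)%:R * (1 - \sum_l x ord0 l).
Proof.
split=> [|[x1 xc]].
  apply: conv_facet_ineq => _ [[j _ <-]|->].
    rewrite (bigD1 j) //= big1 => [|i ij]; last by rewrite mxE (negbTE ij) andbF.
    rewrite mxE !eqxx addr0 subrr; split=> // i.
    by rewrite mulr0 addr0 mxE mulr_ge0.
  have -> : \sum_i apex ord0 i = - \sum_i (c i)%:R.
    by rewrite -sumrN; apply: eq_bigr => i _; rewrite apexE.
  split=> [|i].
    by rewrite (@le_trans _ _ 0) // oppr_le0 sumr_ge0.
  by rewrite apexE volE; lra.
have [v [d [Vv d0 dS d1 ->]]] := barycentric x.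
exists n.+1, v, d; split=> // i.
case: (unliftP ord0 i) => [j|] ->; rewrite ?d0 ?dS.
  rewrite -(pmulr_rge0 _ vol_gt0) mulrDr mulrCA [vol%:R * (_ / _)]mulrC.
  by rewrite divfK // lt0r_neq0 // vol_gt0.
by rewrite divr_ge0 // subr_ge0.
Qed.

Lemma aff_wsimplex : aff wsimplex = setT.
Proof.
apply/seteqP; split=> // x _.
have [v [d [Vv _ _ d1 ->]]] := barycentric x.
by exists n.+1, v, d; split=> // i; apply: conv_gen.
Qed.

End WeightedSimplex.

Arguments apex R {n} c.
Arguments wsimplex R {n} c.

(** * Arithmetic consequences of reflexivity and integer decomposition *)

Section ReflexiveIDP.
Variables (R : realType) (n : nat) (c : 'I_n -> nat).
Hypothesis c_gt0 : forall i, (0 < c i)%N.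

Local Notation vol := ((\sum_i c i).+1).

(* On the polar the [j]-th coordinate has minimum [1 - vol / c j]; if the polar
   is a lattice polytope, this minimum is attained at a lattice point. *)
Lemma reflexive_dvd (j : 'I_n) :
  reflexive_polytope (wsimplex R c) -> (c j %| vol)%N.
Proof.
case=> _ _ [s [sZ polE]].
have cj0 : 0 < (c j)%:R :> R by rewrite ltr0n.
set mu : R := 1 - vol%:R / (c j)%:R.
have cmu : (c j)%:R * mu = (c j)%:R - vol%:R.
  by rewrite mulrBr mulr1 mulrC divfK // lt0r_neq0.
have sum_delta (l : 'I_n) (y : 'rV[R]_n) :
    \sum_i (delta_mx ord0 l : 'rV[R]_n) ord0 i * y ord0 i = y ord0 l.
  rewrite (bigD1 l) //= big1 => [|i il]; first by rewrite mxE !eqxx mul1r addr0.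
  by rewrite mxE (negbTE il) andbF mul0r.
have sum_apex (y : 'rV[R]_n) : \sum_i (apex R c) ord0 i * y ord0 i =
    - ((c j)%:R * y ord0 j) - \sum_(i < n | i != j) (c i)%:R * y ord0 i.
  rewrite (bigD1 j) //= apexE mulNr -sumrN; congr (_ + _).
  by apply: eq_bigr => i _; rewrite apexE mulNr.
have volj : vol%:R = 1 + (c j)%:R + \sum_(i < n | i != j) (c i)%:R :> R.
  by rewrite volE (bigD1 j) //= addrA.
(* The polar inequality at the apex is combined with those at [e_i], [i != j], weighted by [c i]. *)
have mu_min y : polar (wsimplex R c) y -> mu <= y ord0 j.
  move=> Py; rewrite -(ler_pM2l cj0) cmu.
  have := Py _ (conv_gen (or_intror erefl)); rewrite sum_apex => apex_le.
  have : \sum_(i < n | i != j) (c i)%:R * y ord0 i <=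
      \sum_(i < n | i != j) (c i)%:R.
    apply: ler_sum => i _; rewrite -[leRHS]mulr1 ler_wpM2l //.
    have := Py _ (conv_gen (or_introl (ex_intro2 _ _ i I erefl))).
    by rewrite sum_delta.
  by move=> ?; lra.
(* This is the polar vertex dual to the facet opposite [e_j]: its pairing with every other vertex
   equals 1. *)
pose y : 'rV[R]_n := \row_i (if i == j then mu else 1).
have Py : polar (wsimplex R c) y.
  move=> x; apply: conv_le => _ [[l _ <-]|->].
    rewrite sum_delta mxE; case: eqP => // _.
    by rewrite gerBl divr_ge0.
  rewrite sum_apex mxE eqxx cmu.
  under [X in _ - X]eq_bigr => i ij do rewrite mxE (negbTE ij) mulr1.
  by rewrite volj; lra.
move: (Py); rewrite polE => -[m [v [d [sv d0 d1 yE]]]].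
have v_ge t : mu <= v t ord0 j.
  by apply: mu_min; rewrite polE; apply: conv_gen.
(* A convex combination attaining the minimum uses only points attaining it, so a generator of
   nonzero weight has [j]-th coordinate [mu]. *)
have sum0 : \sum_t d t * (v t ord0 j - mu) = 0.
  under eq_bigr do rewrite mulrBr.
  rewrite sumrB -mulr_suml d1 mul1r.
  have := congr1 (fun z : 'rV[R]_n => z ord0 j) yE.
  rewrite mxE eqxx summxE => ->; apply/eqP; rewrite subr_eq0; apply/eqP.
  by apply: eq_bigr => t _; rewrite mxE.
have [t dt] : exists t, d t != 0.
  apply: contrapT => /forallNP dn; have := oner_neq0 R; rewrite -d1 big1 ?eqxx//.
  by move=> t _; apply/eqP; apply: contraT => /dn.
have vt : v t ord0 j = mu.
  have /psumr_eq0P : forall t, true -> 0 <= d t * (v t ord0 j - mu).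
    by move=> u _; rewrite mulr_ge0 ?subr_ge0.
  move=> /(_ sum0 t isT) /eqP; rewrite mulf_eq0 (negbTE dt) subr_eq0 /=.
  by move/eqP.
have /intrP [z zE] : mu \is a Num.int by rewrite -vt; apply: sZ.
have : ((c j)%:Z * z)%:~R = ((c j)%:Z - vol%:Z)%:~R :> R.
  by rewrite intrM intrD rmorphN /= -zE cmu.
move/intr_inj => eqz.
rewrite -[(_ %| _)%N]/(`|(c j)%:Z| %| `|vol%:Z|)%N -dvdzE.
apply/dvdzP; exists (1 - z).
by rewrite mulrBl mul1r [z * _]mulrC eqz subKr.
Qed.

(* With [M = c j] maximal and [S = 1 + \sum_(c i < M) c i = h * M], the lattice
   point [- \sum_(c i = M) e_i] lies in the [h]-th dilate, on the facet opposite
   to [e_j], where its barycentric coordinates other than the apex one are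
   [< 1]; a summand with zero [j]-th coordinate would be some [e_i]. *)
Lemma idp_max_weight (j : 'I_n) :
  (forall i, (c i <= c j)%N) -> (c j %| vol)%N ->
  integer_decomposition_property (wsimplex R c) ->
  ((\sum_(i < n | (c i < c j)%N) c i).+1 = c j)%N.
Proof.
move=> cmax dvdN idp; set M := c j in cmax dvdN *.
set S := (X in X.+1); pose m := #|[set i | c i == M]%SET|.
have M0 : (0 < M)%N by apply: c_gt0.
have volE1 : vol = (S.+1 + m * M)%N.
  rewrite (bigID (fun i => c i < M)%N) /= -/S addSn; congr (_ + _).+1.
  rewrite /m -sum1_card big_distrl /=; apply: eq_big => i.
    by rewrite inE -leqNgt eqn_leq cmax.
  by rewrite -leqNgt mul1n => Mi; apply/eqP; rewrite eqn_leq cmax.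
have /dvdnP [h hE] : (M %| S.+1)%N.
  by move: dvdN; rewrite volE1 dvdn_addl // dvdn_mull.
have h0 : (0 < h)%N by case: h hE.
rewrite hE; suff -> : h = 1%N by rewrite mul1n.
apply/eqP; rewrite eqn_leq h0 andbT leqNgt; apply/negP => h2.
pose w : 'rV[R]_n := \row_i - (c i == M)%:R.
have sumw : \sum_i w ord0 i = - m%:R.
  under eq_bigr do rewrite mxE.
  rewrite sumrN -natr_sum /m -sum1_card [in RHS]big_mkcond /=; congr (- _%:R).
  by apply: eq_bigr => i _; rewrite inE; case: eqP.
have hR0 : 0 < h%:R :> R by rewrite ltr0n.
have volR : vol%:R = M%:R * (h%:R + m%:R) :> R.
  by rewrite volE1 hE -mulnDl natrM natrD mulrC.
have hm0 : 0 < h%:R + m%:R :> R by rewrite ltr_wpDr.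
have [x [Dx wE]] : exists x : 'I_h -> 'rV[R]_n,
    (forall i, (wsimplex R c `&` lattice R n) (x i)) /\ w = \sum_i x i.
  apply: idp => //; split; last first.
    by move=> i; rewrite mxE rpredN rpred_nat.
  exists (h%:R^-1 *: w); last by rewrite scalerA divff ?scale1r ?lt0r_neq0.
  have sumhw : \sum_i (h%:R^-1 *: w) ord0 i = h%:R^-1 * - m%:R.
    by rewrite -sumw mulr_sumr; apply: eq_bigr => i _; rewrite mxE.
  apply/wsimplexP; rewrite sumhw; split.
    by rewrite (@le_trans _ _ 0) // mulrN oppr_le0 mulr_ge0 // invr_ge0 ltW.
  move=> i; rewrite volR !mxE.
  rewrite (_ : _ + _ = h%:R^-1 * (h%:R + m%:R) * ((c i)%:R - M%:R * (c i == M)%:R)).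
    apply: mulr_ge0; first by apply: mulr_ge0; rewrite ?invr_ge0 ltW.
    by case: eqP => [->|_]; rewrite ?mulr1 ?mulr0 ?subrr ?subr0.
  by field; rewrite lt0r_neq0.
(* [vol] times the barycentric coordinate at [e_i]: nonnegative on each summand, with total over the
   summands fixed by [w]. *)
pose lam (i : 'I_n) (z : 'rV[R]_n) : R :=
  vol%:R * z ord0 i + (c i)%:R * (1 - \sum_l z ord0 l).
have lam_ge0 i t : 0 <= lam i (x t).
  by have [/wsimplexP [_ xc] _] := Dx t; apply: xc.
have sum_lam i : \sum_t lam i (x t) =
    (h%:R + m%:R) * ((c i)%:R - M%:R * (c i == M)%:R).
  rewrite big_split -!mulr_sumr /= -summxE -wE sumrB.
  rewrite [\sum_(t < h) \sum_(l < n) _]exchange_big /=.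
  under [X in _ * (_ - X)]eq_bigr do rewrite -summxE -wE.
  rewrite sumw sumr_const card_ord mxE volR; ring.
(* The total at [j] vanishes, so every summand lies on the facet opposite [e_j]. *)
have lamj0 t : lam j (x t) = 0.
  apply: (psumr_eq0P _ (_ : \sum_t lam j (x t) = 0)) => //.
  by rewrite sum_lam eqxx mulr1 subrr mulr0.
have MR0 : 0 < M%:R :> R by rewrite ltr0n.
have xj_le t : x t ord0 j <= 0.
  have [/wsimplexP [xt1 _] _] := Dx t.
  rewrite -(pmulr_rle0 _ (vol_gt0 R c)).
  have := lamj0 t; rewrite /lam -/M => /eqP; rewrite addr_eq0 => /eqP ->.
  by rewrite oppr_le0 mulr_ge0 ?subr_ge0.
have xZ t l : x t ord0 l \is a Num.int by have [_] := Dx t.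
(* The [j]-th coordinates are nonpositive integers with sum -1; were all [h >= 2] of them nonzero,
   the sum would be at most [- h]. *)
have [t xt0] : exists t, x t ord0 j = 0.
  apply: contrapT => /forallNP xn.
  have : w ord0 j <= \sum_(t < h) (- 1).
    rewrite wE summxE; apply: ler_sum => t _.
    have /intrP [z zE] := xZ t j.
    have := xj_le t; have := xn t; rewrite zE lerz0 => zn z0.
    have {}zn : z <> 0 by move=> z00; apply: zn; rewrite z00.
    by rewrite -[-1]/((-1)%:~R) ler_int; lia.
  rewrite mxE eqxx sumr_const card_ord mulNrn lerN2 ler_nat.
  by rewrite leqNgt h2.
(* The apex coordinate of [x t] is thus zero, which makes [x t] a nonnegative integer vector of sum
   1. *)
have sum1 : \sum_l x t ord0 l = 1.
  have := lamj0 t; rewrite /lam xt0 mulr0 add0r => /eqP.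
  by rewrite mulf_eq0 pnatr_eq0 gtn_eqF //= subr_eq0 => /eqP <-.
have lam_t i : lam i (x t) = vol%:R * x t ord0 i.
  by rewrite /lam sum1 subrr mulr0 addr0.
have [i xi0] : exists i, x t ord0 i != 0.
  apply: contrapT => /forallNP xn; have := oner_neq0 R.
  rewrite -sum1 big1 ?eqxx // => l _; apply/eqP; apply: contraT => /xn.
  by [].
have xi1 : 1 <= x t ord0 i.
  have := lam_ge0 i t; rewrite lam_t (pmulr_rge0 _ (vol_gt0 R c)).
  have /intrP [z zE] := xZ t i; move: xi0; rewrite zE intr_eq0 => zn.
  by rewrite ler0z -[1]/(1%:~R) ler_int; lia.
(* One summand alone contributes at least [vol = M * (h + m)] at [i], while the total there is 0 if
   [c i = M] and [(h + m) * c i] otherwise. *)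
have : lam i (x t) <= \sum_t lam i (x t).
  by rewrite (bigD1 t) //= lerDl sumr_ge0.
rewrite lam_t sum_lam volR => le1.
have : M%:R * x t ord0 i <= (c i)%:R - M%:R * (c i == M)%:R.
  by rewrite -(ler_pM2l hm0) mulrA [_ * M%:R]mulrC.
have : M%:R <= M%:R * x t ord0 i by rewrite ler_peMr // ltW.
move=> /le_trans h1 /h1; apply/negP; rewrite -ltNge.
case: eqP => [->|/eqP ne]; first by rewrite mulr1 subrr.
by rewrite mulr0 subr0 ltr_nat ltn_neqAle ne cmax.
Qed.

End ReflexiveIDP.

(** * The free sum decomposition *)

Section FreeSum.
Variable R : realType.

Lemma mulmx_const (a m : nat) (z : R) (x : 'rV[R]_a) :
  x *m (const_mx z : 'M[R]_(a, m)) = const_mx ((\sum_i x ord0 i) * z).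
Proof.
apply/matrixP => i j; rewrite !mxE mulr_suml [i]ord1.
by apply: eq_bigr => l _; rewrite mxE.
Qed.

Lemma sum_row_mx (a m : nat) (x : 'rV[R]_a) (y : 'rV[R]_m) :
  \sum_i row_mx x y ord0 i = \sum_i x ord0 i + \sum_j y ord0 j.
Proof.
by rewrite big_split_ord; congr (_ + _); apply: eq_bigr => i _;
  rewrite ?row_mxEl ?row_mxEr.
Qed.

(* The summands meet in the point [(0, -1, ..., -1)], which [f] moves to [0]. *)
Lemma wsimplex_free_sum (a m n : nat) (p : 'I_a -> nat) (u : 'I_m -> nat)
    (C : nat -> nat) :
  n = (a + m)%N -> (forall j, u j = 1%N) ->
  (forall i : 'I_a, C i = p i) ->
  (forall j : 'I_m, C (a + j)%N = (\sum_i p i).+1) ->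
  exists P Q : set 'rV[R]_n,
    [/\ unimodular_equivalent (wsimplex R p) P,
        unimodular_equivalent (wsimplex R u) Q,
        affine_free_sum P Q
      & wsimplex R (fun i : 'I_n => C i) = conv (P `|` Q)].
Proof.
move=> -> u1 Cp CM; set M := (\sum_i p i).+1 in CM.
(* [g] fixes the first [e_i] and sends the apex of [p] to [(-p, -M, ..., -M)], the apex of the large
   simplex; [g'] inserts the last [m] coordinates. *)
pose A : 'M[int]_(a, a + m) := row_mx 1%:M (const_mx 1).
pose b : 'rV[int]_(a + m) := row_mx 0 (const_mx (-1)).
pose A' : 'M[int]_(m, a + m) := row_mx 0 1%:M.
pose g (x : 'rV[R]_a) : 'rV[R]_(a + m) := x *m map_mx intr A + map_mx intr b.
pose g' (y : 'rV[R]_m) : 'rV[R]_(a + m) :=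
  y *m map_mx intr A' + map_mx intr (0 : 'rV[int]_(a + m)).
have gE x : g x = row_mx x (const_mx (\sum_i x ord0 i - 1)).
  rewrite /g /A /b !map_row_mx map_mx1 map_mx0 !map_const_mx mul_mx_row mulmx1.
  rewrite mulmx_const add_row_mx addr0; congr row_mx.
  by apply/matrixP => i j; rewrite !mxE mulr1.
have g'E y : g' y = row_mx 0 y.
  by rewrite /g' /A' map_row_mx map_mx1 !map_mx0 mul_mx_row mulmx1 mulmx0 addr0.
(* The shear flattens the image of [g] onto the first [a] coordinates; on the image of [g'] it is
   the identity, so [f] only translates there. *)
pose U : 'M[int]_(a + m) := block_mx 1%:M (const_mx (-1)) 0 1%:M.
pose t : 'rV[int]_(a + m) := row_mx 0 (const_mx 1).
pose f (x : 'rV[R]_(a + m)) := x *m map_mx intr U + map_mx intr t.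
have fE x y : f (row_mx x y) = row_mx x (y - const_mx (\sum_i x ord0 i - 1)).
  rewrite /f /U /t map_block_mx map_row_mx !map_mx1 !map_mx0 !map_const_mx.
  rewrite mul_row_block !mulmx1 !mulmx0 !addr0 mulmx_const add_row_mx addr0.
  by congr row_mx; apply/matrixP => i j; rewrite !mxE; ring.
set D := wsimplex R p; set D' := wsimplex R u.
have fP : f @` (g @` D) =
    [set x *m (row_mx 1%:M 0 : 'M[R]_(a, a + m)) + 0 | x in D].
  rewrite image_comp; apply: eq_imagel => x _ /=.
  by rewrite gE fE subrr mul_mx_row mulmx1 mulmx0 addr0.
have fQ : f @` (g' @` D') =
    [set y *m (row_mx 0 1%:M : 'M[R]_(m, a + m)) + row_mx 0 (const_mx 1) | y in D'].
  rewrite image_comp; apply: eq_imagel => y _ /=.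
  rewrite g'E fE mul_mx_row mulmx1 mulmx0 add_row_mx addr0; congr row_mx.
  by rewrite big1 => [|i _]; rewrite ?mxE // sub0r; apply/matrixP => i j;
    rewrite !mxE opprK.
have sumu : (\sum_j u j = m)%N.
  by under eq_bigr do rewrite u1; rewrite sum1_card card_ord.
(* Normalized volumes multiply: [M] for [p], [m.+1] for [u]. *)
have sumC : ((\sum_(i < a + m) C i).+1 = M * m.+1)%N.
  rewrite big_split_ord /=; under eq_bigr do rewrite Cp.
  under [X in (_ + X)%N]eq_bigr do rewrite CM.
  by rewrite sum_nat_const card_ord -addSn mulnS mulnC.
exists (g @` D), (g' @` D'); split.
- apply: (@unimodular_equivalent_embedding _ _ _ _ _ (col_mx 1%:M 0)).
  by rewrite mul_row_col mulmx1 mulmx0 addr0.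
- apply: (@unimodular_equivalent_embedding _ _ _ _ _ (col_mx 0 1%:M)).
  by rewrite mul_row_col mulmx1 mulmx0 add0r.
- exists f; split.
  + exists U, t; split=> //.
    by rewrite unitmxE det_ublock !det1 mulr1 unitr1.
  + rewrite fP fQ; apply/seteqP; split=> z /=.
      move=> [[x _ <-] [y _]]; rewrite addr0 !mul_mx_row !mulmx1 !mulmx0.
      by rewrite add_row_mx addr0 => /eq_row_mx [<- _]; rewrite row_mx0.
    move=> ->; split.
      exists 0; last by rewrite mul0mx addr0.
      apply/wsimplexP; rewrite big1 => [|i _]; last by rewrite mxE.
      by split=> // i; rewrite mxE mulr0 add0r subr0 mulr1.
    (* This is the apex of [D']; its counterpart in [D] is the origin. *)
    exists (const_mx (-1)).
      have sumE : \sum_i (const_mx (-1) : 'rV[R]_m) ord0 i = - m%:R.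
        by under eq_bigr do rewrite mxE; rewrite sumr_const card_ord mulNrn.
      apply/wsimplexP; rewrite sumE sumu; split=> [|i].
        by rewrite (@le_trans _ _ 0) // oppr_le0.
      by rewrite mxE u1 -[m.+1%:R]natr1; lra.
    rewrite mul_mx_row mulmx1 mulmx0 add_row_mx addr0.
    rewrite -[RHS]row_mx0; congr row_mx.
    by apply/matrixP => i j; rewrite !mxE addNr.
  + exists [set i : 'I_(a + m) | (i < a)%N]%SET,
      [set i : 'I_(a + m) | (a <= i)%N]%SET; split.
    * by move=> i; rewrite !inE -ltnNge.
    * rewrite fP aff_image aff_wsimplex; apply/seteqP; split=> z.
        move=> [x _ <-] i; rewrite inE -leqNgt addr0 mul_mx_row mulmx0 mulmx1.
        case: (splitP i) => [k ->|k ik _]; first by rewrite leqNgt ltn_ord.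
        by rewrite (_ : i = rshift a k) ?row_mxEr ?mxE //; apply: val_inj.
      move=> z0; exists (lsubmx z) => //.
      rewrite addr0 mul_mx_row mulmx0 mulmx1 -[RHS]hsubmxK; congr row_mx.
      by apply/rowP => k; rewrite !mxE z0 // inE /= -leqNgt leq_addr.
    * rewrite fQ aff_image aff_wsimplex; apply/seteqP; split=> z.
        move=> [y _ <-] i; rewrite inE -ltnNge mul_mx_row mulmx0 mulmx1.
        rewrite add_row_mx addr0.
        case: (splitP i) => [k ik _|] //.
        by rewrite (_ : i = lshift m k) ?row_mxEl ?mxE //; apply: val_inj.
      move=> z0; exists (rsubmx z - const_mx 1) => //.
      rewrite mul_mx_row mulmx0 mulmx1 add_row_mx addr0 subrK -[RHS]hsubmxK.
      congr row_mx.
      by apply/rowP => k; rewrite !mxE z0 // inE /= -ltnNge.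
- have PQ_sub : g @` D `|` g' @` D' `<=` wsimplex R (fun i : 'I_(a + m) => C i).
    move=> _ [[x /wsimplexP [x1 xp] <-]|[y /wsimplexP [y1 yu] <-]].
      (* On [g x], one minus the coordinate sum is [m.+1] times its value on [x]. The inequalities
         at the first [a] indices are therefore [m.+1] times those of [D], and those at the last [m]
         are equalities. *)
      apply/wsimplexP; rewrite gE sum_row_mx sumC -/M natrM -natr1.
      have -> : \sum_j (const_mx (\sum_i x ord0 i - 1) : 'rV[R]_m) ord0 j =
          m%:R * (\sum_i x ord0 i - 1).
        by under eq_bigr do rewrite mxE; rewrite sumr_const card_ord mulr_natl.
      have m0 : 0 <= m%:R :> R by [].
      split=> [|i]; first by nra.
      case: (splitP i) => [k ik|k ik].
        rewrite (_ : i = lshift m k) ?row_mxEl; last exact: val_inj.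
        by rewrite Cp; have := xp k; rewrite -/M; nra.
      rewrite (_ : i = rshift a k) ?row_mxEr; last exact: val_inj.
      by rewrite CM mxE; lra.
    (* Here the inequalities at the last [m] indices are [M] times those of [D']. *)
    apply/wsimplexP; rewrite g'E sum_row_mx sumC -/M natrM.
    rewrite [\sum_(i < a) _]big1 ?add0r; last by move=> k _; rewrite mxE.
    split=> // i; case: (splitP i) => [k ik|k ik].
      rewrite (_ : i = lshift m k) ?row_mxEl; last exact: val_inj.
      by rewrite mxE mulr0 add0r mulr_ge0 ?subr_ge0.
    rewrite (_ : i = rshift a k) ?row_mxEr; last exact: val_inj.
    rewrite CM -mulrA -mulrDr mulr_ge0 //.
    by have := yu k; rewrite sumu u1 mul1r.
  apply/seteqP; split.
    (* Each vertex of the large simplex is a vertex of a summand: the first [a] unit vectors and the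
       apex come from [g], the other unit vectors from [g']. *)
    apply: conv_mono => _ [[i _ <-]|->].
      case: (splitP i) => [k ik|k ik]; [left|right].
        exists (delta_mx ord0 k); first by apply: conv_gen; left; exists k.
        rewrite gE (_ : i = lshift m k); last exact: val_inj.
        rewrite (_ : \sum_i _ = 1) ?subrr.
          by rewrite delta_mx_lshift.
        rewrite (bigD1 k) //= big1 => [|l lk].
          by rewrite mxE !eqxx addr0.
        by rewrite mxE (negbTE lk) andbF.
      exists (delta_mx ord0 k); first by apply: conv_gen; left; exists k.
      rewrite g'E (_ : i = rshift a k); last exact: val_inj.
      by rewrite delta_mx_rshift.
    left; exists (apex R p); first by apply: conv_gen; right.
    rewrite gE -[RHS]hsubmxK; congr row_mx; apply/rowP => k.
      by rewrite apexE [RHS]mxE apexE Cp.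
    rewrite mxE [RHS]mxE [RHS]apexE CM /M -natr1 natr_sum.
    rewrite opprD -sumrN; congr (_ - _).
    by apply: eq_bigr => i _; rewrite apexE.
  move=> z zPQ; apply/wsimplexP; apply: conv_facet_ineq zPQ => y /PQ_sub.
  by move/wsimplexP.
Qed.

End FreeSum.

(** * Splitting weight vectors at their maximum, and finiteness *)

Lemma sorted_nseq (m x : nat) : sorted leq (nseq m x).
Proof. by elim: m => [|[|m] IHm] //=; rewrite leqnn. Qed.

Lemma sorted_max_split (q : seq nat) (M : nat) :
  sorted leq q -> all (geq M) q ->
  q = [seq x <- q | (x < M)%N] ++ nseq (count_mem M q) M.
Proof.
move=> q_sorted qM; apply: (sorted_eq leq_trans anti_leq) => //.
  rewrite (sorted_pairwise leq_trans) pairwise_cat -!(sorted_pairwise leq_trans).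
  rewrite sorted_nseq sorted_filter ?andbT //=; last exact: leq_trans.
  apply/allrelP => x y; rewrite mem_filter => /andP[/ltnW xM _].
  by rewrite mem_nseq => /andP[_ /eqP ->].
rewrite -{1}(perm_filterC (fun x => x < M)%N q) perm_cat2l.
rewrite (_ : [seq x <- q | _] = [seq x <- q | x == M]).
  by rewrite -size_filter -(all_pred1P _ _ (filter_all _ _)).
apply: eq_in_filter => x /(allP qM) /= xM.
by rewrite -leqNgt eqn_leq xM.
Qed.

Lemma reflexive_idp_decomposes (R : realType) (q : seq nat) (M : nat) :
  weight_vector q -> M \in q -> all (geq M) q -> (1 < M)%N ->
  reflexive_polytope (Delta1 R q) ->
  integer_decomposition_property (Delta1 R q) ->
  decomposes_as_affine_free_sum R q.
Proof.
move=> [q_sorted q_gt0] Mq qM M1 refl idp.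
pose c (i : 'I_(size q)) := nth 0%N q i.
have c_gt0 i : (0 < c i)%N by apply/(allP q_gt0)/mem_nth.
have jP : (index M q < size q)%N by rewrite index_mem.
pose j := Ordinal jP; have cj : c j = M by apply: nth_index.
have cmax i : (c i <= c j)%N by rewrite cj; apply/(allP qM)/mem_nth.
have := idp_max_weight c_gt0 cmax (reflexive_dvd c_gt0 j refl) idp.
set p := [seq x <- q | (x < M)%N]; pose m := count_mem M q.
have m_gt0 : (0 < m)%N by rewrite -has_count has_pred1.
have qE : q = p ++ nseq m M by apply: sorted_max_split.
have sum_p : (\sum_(i < size p) nth 0 p i)%N = sumn p.
  by rewrite sumnE (big_nth 0%N) big_mkord.
rewrite cj (_ : (\sum_(i < _ | _) _)%N = sumn p) => [sumM|]; last first.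
  by rewrite sumnE big_filter (big_nth 0%N) big_mkord.
(* An empty [p] would give [M = 1]. Nonemptiness of [p] and [m > 0] make both summands
   lower-dimensional. *)
have p_gt0 : (0 < size p)%N by case: (p) sumM M1 => //= <-.
have size_q : size q = (size p + size (nseq m 1%N))%N.
  by rewrite {1}qE size_cat !size_nseq.
have ltm (i : 'I_(size (nseq m 1%N))) : (i < m)%N.
  by apply: leq_trans (ltn_ord i) _; rewrite size_nseq.
exists p, (nseq m 1%N); split; last first.
  apply: (wsimplex_free_sum R (C := nth 0%N q) size_q) => i.
  - by rewrite nth_nseq ltm.
  - by rewrite {1}qE nth_cat ltn_ord.
  - rewrite {1}qE nth_cat ltnNge leq_addr addKn nth_nseq ltm.
    by rewrite sum_p sumM.
split.
- split; first by apply: sorted_filter => //; apply: leq_trans.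
  by apply/allP => x; rewrite mem_filter => /andP[_ /(allP q_gt0)].
- by split; [apply: sorted_nseq | apply/allP => x; rewrite mem_nseq => /andP[_ /eqP ->]].
- by rewrite size_q size_nseq -[ltnLHS]addn0 ltn_add2l.
- by rewrite size_q -[ltnLHS]add0n ltn_add2r.
Qed.

Lemma sorted_multiplicity_vector (k : nat) (r x : k.-tuple nat) :
  (forall i j : 'I_k, (i < j)%N -> (tnth r i < tnth r j)%N) ->
  sorted leq (multiplicity_vector r x).
Proof.
move=> r_lt; rewrite (sorted_pairwise leq_trans) /multiplicity_vector.
have : pairwise (fun i j : 'I_k => i < j)%N (enum 'I_k).
  rewrite -(pairwise_map val ltn) val_enum_ord -(sorted_pairwise ltn_trans).
  exact: iota_ltn_sorted.
elim: (enum 'I_k) => //= i s IHs /andP[i_s /IHs s_sorted].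
rewrite pairwise_cat s_sorted andbT; apply/andP; split; last first.
  by rewrite -(sorted_pairwise leq_trans) sorted_nseq.
apply/allrelP => a b; rewrite mem_nseq => /andP[_ /eqP ->].
move=> /flatten_mapP [l /(allP i_s) /r_lt/ltnW il].
by rewrite mem_nseq => /andP[_ /eqP ->].
Qed.

Theorem theorem3p7 (R : realType) (k : nat) (r : k.-tuple nat)
  (r_gt0 : forall i : 'I_k, (0 < tnth r i)%N)
  (r_lt : forall i j : 'I_k, (i < j)%N -> (tnth r i < tnth r j)%N)
  (r_neq1 : tval r <> [:: 1%N]) :
  finite_set [set q : seq nat |
    (exists2 x : k.-tuple nat, (forall i : 'I_k, (0 < tnth x i)%N)
        & q = multiplicity_vector r x) /\
    [/\ reflexive_polytope (Delta1 R q),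
        integer_decomposition_property (Delta1 R q)
      & ~ decomposes_as_affine_free_sum R q]].
Proof.
(* Only the empty vector, arising for [k = 0], can survive; for [k > 0] the largest entry is the
   last [r_i]. *)
apply: (@sub_finite_set _ _ [set [::]]); last exact: finite_set1.
move=> q /= [[x x_gt0 qE] [refl idp ndec]].
case: k => [|k] in r r_gt0 r_lt r_neq1 x x_gt0 qE *.
  by rewrite qE /multiplicity_vector enum_ord0.
case: ndec; pose M := tnth r ord_max.
have mem_q y : y \in q -> exists i, y = tnth r i.
  rewrite qE => /flatten_mapP [i _]; rewrite mem_nseq => /andP[_ /eqP ->].
  by exists i.
have r_max i : (tnth r i <= M)%N.
  case: (ltngtP i (@ord_max k)) => [/r_lt/ltnW //||/val_inj -> //].
  by rewrite ltnNge -ltnS ltn_ord.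
apply: (@reflexive_idp_decomposes R q M) => //.
- split; first by rewrite qE; apply: sorted_multiplicity_vector.
  by apply/allP => y /mem_q [i ->]; apply: r_gt0.
- rewrite qE; apply/flatten_mapP; exists ord_max; first by rewrite mem_enum.
  by rewrite mem_nseq x_gt0 eqxx.
- by apply/allP => y /mem_q [i ->]; apply: r_max.
(* A single value must differ from 1 by [r_neq1]; with several, the last exceeds the first, which is
   positive. *)
- case: k => [|k] in r r_gt0 r_lt r_neq1 x x_gt0 qE M mem_q r_max *.
    rewrite ltn_neqAle r_gt0 andbT; apply/eqP => M1; apply: r_neq1.
    transitivity [:: M]; last by rewrite -M1.
    by rewrite /M (tnth_nth 0%N); case: (tval r) (size_tuple r) => [|y [|z s]].
  exact: leq_ltn_trans (r_gt0 ord0) (r_lt _ _ _).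
Qed.
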